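(* Let $f:\mathbb{R}^n\to\mathbb{R}$ be a convex $L$-smooth function for some $L\in(0,\infty)$, and let $x_0\in\mathbb{R}^n$. Let $x:[0,\infty)\to\mathbb{R}^n$ be the gradient flow of $f$ started at $x_0$, i.e. the unique solution of $x'(t)=-\nabla f(x(t))$ for $t\ge 0$, $x(0)=x_0$. Then the resulting gradient flow optimization curve $g:[0,\infty)\to\mathbb{R}$, $g(t)=f(x(t))$, is convex.
   Context: A function $f:\mathbb{R}^n\to\mathbb{R}$ is $L$-smooth if it is differentiable and its gradient is $L$-Lipschitz with respect to the Euclidean norm: $\|\nabla f(x)-\nabla f(y)\|\le L\|x-y\|$ for all $x,y\in\mathbb{R}^n$ (no twice differentiability is assumed). For such $f$, the gradient flow differential equation $x'(t)=-\nabla f(x(t))$, $x(0)=x_0$ has a unique solution on all of $[0,\infty)$ (the derivative at $t=0$ being one-sided), by the Picard–Lindelöf theorem. The optimization curve induced by gradient flow is the function $g(t)=f(x(t))$ on $[0,\infty)$. *)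

(* Defs.v *)
From mathcomp Require Import all_boot all_order all_algebra.
From mathcomp Require Import all_classical all_reals all_analysis.

Set Implicit Arguments.
Unset Strict Implicit.
Unset Printing Implicit Defensive.

Import Order.TTheory GRing.Theory Num.Theory.
Import numFieldNormedType.Exports.

Local Open Scope classical_set_scope.
Local Open Scope ring_scope.

(* The library norm on 'rV[R]_n is the sup norm.  It induces the Euclidean
   topology, so differentiability and limits are unaffected, but Lipschitz
   constants are not: hence this separate Euclidean norm. *)
Definition norm2 (R : realType) (n : nat) (v : 'rV[R]_n) : R :=
  Num.sqrt (\sum_(i < n) v ord0 i ^+ 2).

(* delta_mx ord0 i is the i-th standard basis vector; the definition is meant
   to be used at points where f is differentiable. *)
Definition grad (R : realType) (n : nat) (f : 'rV[R]_n -> R) (p : 'rV[R]_n)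
    : 'rV[R]_n :=
  \row_(i < n) 'D_(delta_mx ord0 i) f p.

Definition smooth (R : realType) (n : nat) (L : R) (f : 'rV[R]_n -> R) : Prop :=
  (forall p : 'rV[R]_n, differentiable f p) /\
  (forall p q : 'rV[R]_n, norm2 (grad f p - grad f q) <= L * norm2 (p - q)).

(* A function on [0, +oo[ is represented by a total function on R whose values
   at negative arguments play no role; at t = 0 the derivative is therefore
   the right derivative. *)
Definition gradient_flow (R : realType) (n : nat) (f : 'rV[R]_n -> R)
    (x0 : 'rV[R]_n) (x : R -> 'rV[R]_n) : Prop :=
  [/\ x 0 = x0,
      h^-1 *: (x h - x 0) @[h --> 0^'+] --> - grad f (x 0)
    & forall t : R, 0 < t -> is_derive t 1 x (- grad f (x t))].

(* Main.v *)
(* The convexity of f makes its gradient monotone, so that the distance between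
   x(t + h) and x(t) is nonincreasing in t.  Dividing by h and letting h tend
   to 0, the norm of x'(t) = - grad f (x t) is nonincreasing too.  Hence
   g'(t) = - |grad f (x t)|^2 is nondecreasing on ]0, +oo[, and g, being
   right-continuous at 0, is convex on [0, +oo[. *)

Require Import Defs.
From mathcomp Require Import all_boot all_order all_algebra.
From mathcomp Require Import all_classical all_reals all_analysis.
From mathcomp Require Import ring lra.

Import Order.TTheory GRing.Theory Num.Theory.
Import numFieldNormedType.Exports.

Local Open Scope classical_set_scope.
Local Open Scope ring_scope.

(** Lengths enter the proof squared, as [dot u u]: this avoids the square root of [norm2], which is
    not differentiable at the origin. *)
Definition dot {R : realType} {n : nat} (u v : 'rV[R]_n) : R :=
  \sum_(i < n) u ord0 i * v ord0 i.

Lemma dotC {R : realType} {n : nat} (u v : 'rV[R]_n) : dot u v = dot v u.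
Proof. by apply: eq_bigr => i _; rewrite mulrC. Qed.

Lemma dotNl {R : realType} {n : nat} (u v : 'rV[R]_n) : dot (- u) v = - dot u v.
Proof. by rewrite -sumrN; apply: eq_bigr => i _; rewrite !mxE mulNr. Qed.

Lemma dotBl {R : realType} {n : nat} (u v w : 'rV[R]_n) :
  dot (u - v) w = dot u w - dot v w.
Proof. by rewrite -sumrB; apply: eq_bigr => i _; rewrite !mxE mulrBl. Qed.

Lemma dotNr {R : realType} {n : nat} (u v : 'rV[R]_n) : dot u (- v) = - dot u v.
Proof. by rewrite dotC dotNl dotC. Qed.

Lemma dotZ {R : realType} {n : nat} (a : R) (u : 'rV[R]_n) :
  dot (a *: u) (a *: u) = a ^+ 2 * dot u u.
Proof. by rewrite mulr_sumr; apply: eq_bigr => i _; rewrite !mxE; ring. Qed.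

(** The differential is linear, so expanding [v] in the standard basis leaves only partial
    derivatives. *)
Lemma derive_grad {R : realType} {n : nat} (f : 'rV[R]_n -> R)
    (p v : 'rV[R]_n) :
  differentiable f p -> 'D_v f p = dot (grad f p) v.
Proof.
move=> df; rewrite deriveE// [in LHS](row_sum_delta v) linear_sum.
by apply: eq_bigr => i _; rewrite linearZ !mxE deriveE// mulrC.
Qed.

(** By convexity, the difference quotient at [p] along [q - p] with step [h] in ]0, 1] is at most
    [f q - f p]; the bound survives the limit as [h] tends to 0 from the right. *)
Lemma convex_ge_tangent {R : realType} {n : nat} (f : 'rV[R]_n -> R)
    (p q : 'rV[R]_n) :
  convex_function (E := 'rV[R]_n) [set: 'rV[R]_n] f ->
  differentiable f p -> dot (grad f p) (q - p) <= f q - f p.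
Proof.
move=> cf df; rewrite -derive_grad//.
have dfv : (fun h : R => h^-1 *: ((f \o shift p) (h *: (q - p)) - f p)) @ 0^'
    --> 'D_(q - p) f p by exact: diff_derivable.
have {}dfv := cvg_dnbhs_at_right dfv.
apply: (cvgr_to_le dfv); near=> h.
have h0 : 0 < h by near: h; exact: nbhs_right_gt.
have h1 : h <= 1 by near: h; exact: nbhs_right_le.
(* [convex_function] takes its weight bundled with a proof that it lies in [0, 1]. *)
have h01 : Itv.spec (@Itv.num_sem R) (Itv.Real `[0%Z, 1%Z]) h.
  by rewrite /= /Itv.num_sem/= num_real/= in_itv/= (ltW h0) h1.
have le_f : f (h *: q + (1 - h) *: p) <= h * f q + (1 - h) * f p.
  by apply: (cf (Itv.mk h01)); rewrite inE.
rewrite /GRing.scale/= ler_pdivrMl//.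
have -> : h *: (q - p) + p = h *: q + (1 - h) *: p.
  by rewrite scalerBr scalerBl scale1r addrAC addrA.
by move: le_f; lra.
Unshelve. all: by end_near. Qed.

(** Add the tangent inequalities at [p] and at [q]: the values of [f] cancel. *)
Lemma grad_monotone {R : realType} {n : nat} (f : 'rV[R]_n -> R)
    (p q : 'rV[R]_n) :
  convex_function (E := 'rV[R]_n) [set: 'rV[R]_n] f ->
  differentiable f p -> differentiable f q ->
  0 <= dot (grad f p - grad f q) (p - q).
Proof.
move=> cf dp dq; rewrite dotBl.
have := convex_ge_tangent f p q cf dp; have := convex_ge_tangent f q p cf dq.
by rewrite -[q - p]opprB dotNr; lra.
Qed.

Lemma is_derive_coord {R : realType} {n : nat} (u : R -> 'rV[R]_n) (t : R)
    (du : 'rV[R]_n) (i : 'I_n) :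
  is_derive t 1 u du -> is_derive t 1 (fun s => u s ord0 i) (du ord0 i).
Proof.
move=> [du1 <-]; rewrite derive_mx// mxE.
by apply/derivableP; move/derivable_mxP: du1; apply.
Qed.

Lemma is_derive_dot_self {R : realType} {n : nat} (u : R -> 'rV[R]_n) (t : R)
    (du : 'rV[R]_n) :
  is_derive t 1 u du ->
  is_derive t 1 (fun s => dot (u s) (u s)) (2 * dot du (u t)).
Proof.
move=> hu.
(* As a sum of products of functions, the expression can be differentiated by instance inference. *)
have -> : (fun s => dot (u s) (u s)) =
   \sum_(i < n) (fun s => u s ord0 i) * (fun s => u s ord0 i).
  by apply/funext => s; rewrite fct_sumE.
have h i := is_derive_coord u t du i hu.
apply: is_derive_eq; rewrite mulr_sumr; apply: eq_bigr => i _.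
by rewrite /GRing.scale/=; ring.
Qed.

Lemma is_derive_comp_grad {R : realType} {n : nat} (f : 'rV[R]_n -> R)
    (u : R -> 'rV[R]_n) (t : R) (du : 'rV[R]_n) :
  differentiable f (u t) -> is_derive t 1 u du ->
  is_derive t 1 (fun s => f (u s)) (dot (grad f (u t)) du).
Proof.
move=> df [/derivable1_diffP du1 <-].
have dc : differentiable (f \o u) t by exact: differentiable_comp.
apply: DeriveDef; first exact/derivable1_diffP.
by rewrite -derive_grad// !deriveE//= diff_comp.
Qed.

Lemma is_derive_shiftr {R : realType} {n : nat} (u : R -> 'rV[R]_n) (h t : R)
    (du : 'rV[R]_n) :
  is_derive (t + h) 1 u du -> is_derive t 1 (fun s => u (s + h)) du.
Proof.
(* Both functions have the same difference quotients, so derivability and derivative transfer by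
   rewriting. *)
have E : (fun k : R =>
    k^-1 *: (((fun s => u (s + h)) \o shift t) (k *: 1) - u (t + h)))
  = (fun k => k^-1 *: ((u \o shift (t + h)) (k *: 1) - u (t + h))).
  by apply/funext => k /=; rewrite addrA.
by move=> [du1 <-]; apply: DeriveDef; rewrite /derivable /derive E.
Qed.

Lemma cvg_dot_self {R : realType} {n : nat} {T : Type}
    {F : set_system T} {FF : Filter F} (u : T -> 'rV[R]_n) (v : 'rV[R]_n) :
  u @ F --> v -> dot (u s) (u s) @[s --> F] --> dot v v.
Proof.
move=> uv; apply: cvg_big => [|i _]; first exact: add_continuous.
have ui : u s ord0 i @[s --> F] --> v ord0 i.
  apply: (@cvg_comp _ _ _ u (fun w => w ord0 i) _ _ _ uv).
  exact: coord_continuous.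
exact: cvgM.
Qed.

(** The time-shifted curve solves the same equation, so the squared distance has derivative -2 times
    the pairing in [grad_monotone], hence nonpositive. *)
Lemma gradient_flow_contracting {R : realType} {n : nat} (f : 'rV[R]_n -> R)
    (x : R -> 'rV[R]_n) (h s t : R) :
  convex_function (E := 'rV[R]_n) [set: 'rV[R]_n] f ->
  (forall p, differentiable f p) ->
  (forall r : R, 0 < r -> is_derive r 1 x (- grad f (x r))) ->
  0 <= h -> 0 < s -> s <= t ->
  dot (x (t + h) - x t) (x (t + h) - x t) <=
  dot (x (s + h) - x s) (x (s + h) - x s).
Proof.
move=> cf df dx h0 s0 st.
pose d (r : R) : 'rV[R]_n := x (r + h) - x r.
have dphi (r : R) : 0 < r -> is_derive r 1 (fun r => dot (d r) (d r))
    (2 * dot (- grad f (x (r + h)) - - grad f (x r)) (d r)).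
  move=> r0; apply: is_derive_dot_self; apply: is_deriveB; last exact: dx.
  by apply: is_derive_shiftr; apply: dx; lra.
have sr r : r \in `[s, +oo[ -> 0 < r by rewrite in_itv/= andbT; lra.
have sr' r : r \in `]s, +oo[ -> 0 < r by rewrite in_itv/= andbT; lra.
apply: (@ler0_derive1_nincry _ (fun r => dot (d r) (d r)) s) => //.
- by move=> r /sr' /dphi [].
- move=> r /sr' /dphi dr; rewrite derive1E derive_val.
  rewrite -opprD dotNl mulrN oppr_le0 mulr_ge0//.
  exact: grad_monotone.
- by apply: derivable_within_continuous => r /sr /dphi [].
Qed.

Lemma gradient_flow_norm_nincr {R : realType} {n : nat} (f : 'rV[R]_n -> R)
    (x : R -> 'rV[R]_n) (s t : R) :
  convex_function (E := 'rV[R]_n) [set: 'rV[R]_n] f ->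
  (forall p, differentiable f p) ->
  (forall r : R, 0 < r -> is_derive r 1 x (- grad f (x r))) ->
  0 < s -> s <= t ->
  dot (grad f (x t)) (grad f (x t)) <= dot (grad f (x s)) (grad f (x s)).
Proof.
move=> cf df dx s0 st.
(* Distances are squared, so the factor is the square of [h^-1]; squaring also removes the sign of
   [- grad f]. *)
have lim (r : R) : 0 < r ->
    h^-1 ^+ 2 * dot (x (r + h) - x r) (x (r + h) - x r) @[h --> 0^'+] -->
    dot (grad f (x r)) (grad f (x r)).
  move=> /dx [dr er].
  have {}dr : h^-1 *: (x (r + h) - x r) @[h --> 0^'] --> - grad f (x r).
    rewrite -er; apply: cvg_trans dr; apply: near_eq_cvg; near=> h.
    by rewrite /= [_%:A]mulr1 [h + r]addrC.
  under eq_cvg do rewrite -dotZ.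
  have -> : dot (grad f (x r)) (grad f (x r)) =
      dot (- grad f (x r)) (- grad f (x r)) by rewrite dotNl dotNr opprK.
  exact/cvg_dot_self/cvg_dnbhs_at_right.
apply: (ler_cvg_to (lim t _) (lim s _)) => //; first by lra.
near=> h; rewrite ler_wpM2l ?exprn_even_ge0//.
apply: gradient_flow_contracting cf df dx _ s0 st.
by near: h; exact: nbhs_right_ge.
Unshelve. all: by end_near. Qed.

(** The mean value theorem on both sides of an intermediate point turns the slopes of the two chords
    into values of [dg], which are ordered. It uses derivatives only inside each interval, so
    continuity suffices at [a]. *)
Lemma nondecreasing_derive_convex {R : realType} (g dg : R -> R) (a : R) :
  {within `[a, +oo[, continuous g} ->
  (forall t, a < t -> is_derive t 1 g (dg t)) ->
  (forall s t, a < s -> s <= t -> dg s <= dg t) ->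
  convex_function (E := R^o) `[a, +oo[ g.
Proof.
move=> cg dgE dg_ndecr.
have mvt u v : a <= u -> u < v ->
    exists2 c, u < c < v & g v - g u = dg c * (v - u).
  move=> au uv; have [||c] := @MVT R g dg u v uv.
  - by move=> r; rewrite in_itv/= => /andP[ur _]; apply: dgE; lra.
  - by apply: continuous_subspaceW cg => r /=; rewrite !in_itv/= andbT; lra.
  - by rewrite in_itv/=; exists c.
have main (u v h : R) : a <= u -> u < v -> 0 < h < 1 ->
   g (h * u + (1 - h) * v) <= h * g u + (1 - h) * g v.
  move=> au uv /andP[h0 h1]; set w := h * u + (1 - h) * v.
  have uw : u < w by rewrite /w; nra.
  have wv : w < v by rewrite /w; nra.
  have [c /andP[uc cw] gc] := mvt _ _ au uw.
  have [d /andP[wd dv] gd] := mvt _ _ (le_trans au (ltW uw)) wv.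
  have cd : dg c <= dg d by apply: dg_ndecr; lra.
  have wu : w - u = (1 - h) * (v - u) by rewrite /w; ring.
  have vw : v - w = h * (v - u) by rewrite /w; ring.
  rewrite -subr_ge0.
  (* The convexity gap is a nonnegative multiple of the difference of the two slopes. *)
  have -> : h * g u + (1 - h) * g v - g w =
    (1 - h) * h * (v - u) * (dg d - dg c).
    have -> : g v = g w + dg d * (h * (v - u)) by rewrite -vw -gd; ring.
    have -> : g w = g u + dg c * ((1 - h) * (v - u)) by rewrite -wu -gc; ring.
    by ring.
  by rewrite !mulr_ge0// ?subr_ge0// ltW.
move=> h u v; rewrite !inE/= !in_itv/= !andbT => au av.
have h0 : 0 <= h%:num by [].
have h1 : h%:num <= 1 by [].
(* Unfold the abstract convex combinations on [R^o] into arithmetic. *)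
change (g (h%:num * u + (1 - h%:num) * v) <=
  h%:num * g u + (1 - h%:num) * g v).
move: h%:num h0 h1 => k; rewrite le0r => /predU1P[-> _|k0].
  by rewrite !mul0r !add0r subr0 !mul1r.
rewrite le_eqVlt => /predU1P[->|k1].
  by rewrite subrr !mul0r !addr0 !mul1r.
have [uv|vu|->] := ltgtP u v.
- by apply: main => //; rewrite k0.
(* Swapping the endpoints exchanges the weights [k] and [1 - k]. *)
- have := main v u (1 - k) av vu; rewrite subKr [X in g X]addrC [leRHS]addrC.
  by apply; lra.
- by rewrite -!mulrDl addrC subrK !mul1r.
Qed.

Theorem theorem5 (R : realType) (n : nat) (f : 'rV[R]_n -> R) (L : R)
    (x0 : 'rV[R]_n) (x : R -> 'rV[R]_n) :
  0 < L ->
  convex_function (E := 'rV[R]_n) [set: 'rV[R]_n] f ->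
  smooth L f ->
  gradient_flow f x0 x ->
  convex_function (E := R^o) `[0, +oo[ (fun t : R => f (x t)).
Proof.
move=> _ cf [df _] [_ dx0 dx].
have dg (t : R) : 0 < t -> is_derive t 1 (fun s => f (x s))
    (- dot (grad f (x t)) (grad f (x t))).
  by move=> t0; rewrite -dotNr; apply: is_derive_comp_grad => //; exact: dx.
apply: (nondecreasing_derive_convex _ _ _ _ dg); last first.
  by move=> s t s0 st; rewrite lerN2; exact: gradient_flow_norm_nincr.
apply/continuous_within_itvcyP; split.
  move=> t; rewrite in_itv/= andbT => /dg[dgt _].
  exact/differentiable_continuous/derivable1_diffP.
suff : x t @[t --> 0^'+] --> x 0.
  by move=> xc; exact: (cvg_comp _ _ xc (differentiable_continuous (df _))).
(* Right continuity at 0 comes from the one-sided derivative: [x h - x 0] is [h] times a convergent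
   quotient. *)
have h0 : (h : R) @[h --> 0^'+] --> (0 : R) by exact: cvg_at_right_filter.
have : h *: (h^-1 *: (x h - x 0)) + x 0 @[h --> 0^'+] -->
    0 *: - grad f (x 0) + x 0 by exact: cvgD (cvgZ h0 dx0) (cvg_cst _).
rewrite scale0r add0r => xc; apply: cvg_trans xc; apply: near_eq_cvg; near=> h.
have hn0 : h != 0 by near: h; exact: nbhs_right_neq.
by rewrite scalerA mulfV// scale1r subrK.
Unshelve. all: by end_near. Qed.
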